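(* Let $G$ be a finite abelian group. Then $\delta(G)\le (2|G|)^{3|G|+1}$.
   Context: $G$ is written additively. A sequence over $G$ is a finite unordered list of elements of $G$ with repetitions (an element of the free abelian monoid $\mathcal{F}(G)$). A zero-sum sequence has sum $0$; a minimal zero-sum sequence is a non-empty zero-sum sequence with no proper non-empty zero-sum subsequence; $\mathcal{A}(G)$ is the set of these. Factorizations are elements of the free abelian monoid $\mathsf{Z}(G)$ over $\mathcal{A}(G)$ (formal unordered products of minimal zero-sum sequences); $\pi:\mathsf{Z}(G)\to\mathcal{F}(G)$ evaluates the product; $|\zeta|$ is the number of factors (with multiplicity); for a zero-sum sequence $B$, $\mathsf{L}(B)=\{|\zeta|: \pi(\zeta)=B\}$. For $\zeta,\xi\in\mathsf{Z}(G)$, $\mathsf{d}(\zeta,\xi)=\max\{|\gcd(\zeta,\xi)^{-1}\zeta|,|\gcd(\zeta,\xi)^{-1}\xi|\}$. Two distinct $k,\ell\in\mathsf{L}(B)$ are adjacent lengths of $B$ if no element of $\mathsf{L}(B)$ lies strictly between them. For $\zeta\in\mathsf{Z}(G)$, $\delta(\zeta)$ is the smallest $m\in\mathbb{N}_0$ such that whenever $k\in\mathbb{N}$ and $k$, $|\zeta|$ are adjacent lengths of $\pi(\zeta)$, there is $\xi\in\mathsf{Z}(G)$ with $\pi(\xi)=\pi(\zeta)$, $|\xi|=k$ and $\mathsf{d}(\xi,\zeta)\le m$. The successive distance is $\delta(G)=\sup\{\delta(\zeta):\zeta\in\mathsf{Z}(G)\}$. *)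

(* Defs.v *)
From HB Require Import structures.
From mathcomp Require Import all_boot all_order all_algebra.
Set Implicit Arguments. Unset Strict Implicit. Unset Printing Implicit Defensive.
Import GRing.Theory.

Section ZeroSum.
Variable G : finZmodType.

(* A sequence over G = element of the free abelian monoid F(G),
   represented by its multiplicity function. *)
Definition gseq := {ffun G -> nat}.

Definition slen (S : gseq) : nat := \sum_(g : G) S g.
Definition ssum (S : gseq) : G := (\sum_(g : G) g *+ S g)%R.
Definition subseqG (T S : gseq) : Prop := forall g, T g <= S g.

Definition zero_sum (S : gseq) : Prop := ssum S = 0%R.

Definition atom (S : gseq) : Prop :=
  0 < slen S /\ zero_sum S /\
  forall T : gseq, subseqG T S -> 0 < slen T -> zero_sum T -> T = S.

(* Factorizations: elements of the free abelian monoid Z(G) over A(G),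
   represented by a list of atoms considered up to order. *)
Definition factorization (z : seq gseq) : Prop := forall A, A \in z -> atom A.

Definition pi (z : seq gseq) : gseq := [ffun g => \sum_(A <- z) A g].

Definition gcd_len (z x : seq gseq) : nat :=
  \sum_(A <- undup z) minn (count_mem A z) (count_mem A x).

Definition fdist (z x : seq gseq) : nat :=
  maxn (size z - gcd_len z x) (size x - gcd_len z x).

Definition in_L (B : gseq) (k : nat) : Prop :=
  exists z, factorization z /\ pi z = B /\ size z = k.

Definition adjacent_lengths (B : gseq) (k l : nat) : Prop :=
  k <> l /\ in_L B k /\ in_L B l /\
  forall m, in_L B m -> ~ (minn k l < m < maxn k l).

Definition delta_prop (z : seq gseq) (m : nat) : Prop :=
  forall k, 0 < k -> adjacent_lengths (pi z) k (size z) ->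
    exists x, factorization x /\ pi x = pi z /\ size x = k /\ fdist x z <= m.

Definition is_delta (z : seq gseq) (m : nat) : Prop :=
  delta_prop z m /\ forall m', delta_prop z m' -> m <= m'.

End ZeroSum.

(* Main.v *)
(** A factorization [x] of length [k] and the given [z] differ by parts [x'] and
    [z'] with the same product. Encode the factors of [x'] as integer vectors
    [(A, 1)], those of [z'] as [(-A, -1)], and add [|k - |z||] copies of
    [(0, -1)] or [(0, 1)] to make the sum zero. By the Steinitz lemma the vectors
    can be ordered so that all partial sums lie in a box depending only on [G].
    If there are more vectors than lattice points in the box, two partial sums
    coincide and the family splits into two zero-sum parts. Since [k] and [|z|]
    are adjacent lengths, one of the parts accounts for the whole difference of
    lengths, and the other one can be cancelled. A minimal difference is thus
    bounded by the number of lattice points. *)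

Require Import Defs.
From mathcomp Require Import all_boot all_order all_algebra.
From mathcomp Require Import fingroup cyclic ring lra zify.
From Stdlib Require Import Classical.
(* [pi] must denote the product of a factorization, not a quotient map. *)
Import Defs.
Set Implicit Arguments. Unset Strict Implicit. Unset Printing Implicit Defensive.
Import Order.TTheory GRing.Theory Num.Theory.

(** * The Steinitz lemma over an ordered field *)

Section Steinitz.
Local Open Scope ring_scope.
Variables (R : realFieldType) (T : finType).

Lemma linear_dependence (J : finType) (u : T -> J -> R) (F : {set T}) :
    (#|J| < #|F|)%N ->
  exists mu : T -> R, [/\ exists2 t, t \in F & mu t != 0,
    forall t, t \notin F -> mu t = 0 &
    forall j, \sum_(t in F) mu t * u t j = 0].
Proof.
move=> ltJF.
have [t0 Ft0] : exists t, t \in F by apply/card_gt0P; apply: leq_trans ltJF.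
pose M := \matrix_(i < #|F|, j < #|J|) u (enum_val i) (enum_val j).
have : kermx M != 0.
  rewrite -mxrank_eq0 mxrank_ker subn_eq0 -ltnNge.
  exact: leq_ltn_trans (rank_leq_col M) ltJF.
case/rowV0Pn => w /sub_kermxP wM0 /rV0Pn [i0 wi0].
exists (fun t => if t \in F then w 0 (enum_rank_in Ft0 t) else 0); split.
- exists (enum_val i0); first exact: enum_valP.
  by rewrite enum_valP enum_valK_in.
- by move=> t /negbTE ->.
move=> j; rewrite big_enum_val /=.
have /rowP/(_ (enum_rank j)) := wM0; rewrite !mxE => h; rewrite -[RHS]h.
by apply: eq_bigr => i _; rewrite enum_valP enum_valK_in !mxE enum_rankK.
Qed.

Definition fractional (V : {set T}) (la : T -> R) : {set T} :=
  [set t in V | 0 < la t < 1].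

Definition weights (V : {set T}) (la : T -> R) : Prop :=
  forall t, t \in V -> 0 <= la t <= 1.

(** Moving from [la] along [mu] until the first fractional weight hits 0 or 1 leaves the other
    weights in range. *)
Lemma move_to_boundary (V : {set T}) (la mu : T -> R) :
    weights V la -> (forall t, t \notin fractional V la -> mu t = 0) ->
    (exists2 t, t \in fractional V la & mu t != 0) ->
  exists e : R, weights V (fun t => la t + e * mu t) /\
    (#|fractional V (fun t => la t + e * mu t)%R| < #|fractional V la|)%N.
Proof.
move=> wV mu0 [t0 Ft0 mut0].
(* [r t] is the step length at which the weight of [t] reaches 1 or 0; the smallest one is used. *)
pose r t := if 0 < mu t then (1 - la t) / mu t else la t / - mu t.
have [t /andP[Ft mut] rmin] :
  exists2 t, (t \in fractional V la) && (mu t != 0) &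
    forall t', t' \in fractional V la -> mu t' != 0 -> r t <= r t'.
  have P0 : (t0 \in fractional V la) && (mu t0 != 0) by rewrite Ft0.
  case: (@arg_minP _ R T t0 (fun t => (t \in fractional V la) && (mu t != 0)) r P0).
  move=> t Pt tmin; exists t => // t' F' mu'.
  by apply: tmin; rewrite F'.
have r_gt0 : 0 < r t.
  move: Ft; rewrite inE => /and3P[_ l0 l1]; rewrite /r.
  case: ifP => [m0|/negbT]; first by rewrite divr_gt0 // subr_gt0.
  by rewrite -leNgt => m0; rewrite divr_gt0 // oppr_gt0 lt_neqAle mut.
have wV' : weights V (fun t' => la t' + r t * mu t').
  move=> t' Vt'; have /andP[l0 l1] := wV _ Vt'.
  have [->|m'] := eqVneq (mu t') 0; first by rewrite mulr0 addr0 l0.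
  have F' : t' \in fractional V la.
    by apply/negPn/negP => /mu0 /eqP; rewrite (negbTE m').
  have := rmin _ F' m'; rewrite {2}/r; case: ifP => [m0|/negbT].
    rewrite ler_pdivlMr // => h.
    have : 0 < r t * mu t' by rewrite mulr_gt0.
    by lra.
  rewrite -leNgt => m0; have {}m0 : mu t' < 0 by rewrite lt_neqAle m'.
  rewrite ler_pdivlMr ?oppr_gt0 // mulrN => h.
  have : r t * mu t' < 0 by rewrite pmulr_rlt0.
  by lra.
exists (r t); split => //; apply: proper_card; apply/properP; split.
  apply/subsetP => t' H'; apply/negPn/negP => Fn'.
  by move: H' (Fn'); rewrite !inE (mu0 _ Fn') mulr0 addr0 => ->.
exists t => //; rewrite inE; move: Ft; rewrite inE => /and3P[-> l0 l1] /=.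
rewrite {1 2}/r; case: ifP => [m0|_].
  by rewrite divfK // addrC subrK ltxx andbF.
by rewrite invrN mulrN mulNr divfK // subrr ltxx.
Qed.

(** A vertex of the polytope of weights with prescribed sums: as long as more than [#|J|] weights
    are fractional, a linear dependence among their vectors gives a direction that keeps all
    sums. *)
Lemma basic_solution (J : finType) (u : T -> J -> R) (V : {set T}) la :
    weights V la ->
  exists la', [/\ weights V la',
    forall j, \sum_(t in V) la' t * u t j = \sum_(t in V) la t * u t j &
    (#|fractional V la'| <= #|J|)%N].
Proof.
have [n] := ubnP #|fractional V la|; elim: n la => // n IH la lt_n wV.
have [|/linear_dependence -/(_ u) [mu [mu1 mu0 muE]]] :=
  leqP #|fractional V la| #|J|; first by exists la.
have [e [wV' lt_e]] := move_to_boundary wV mu0 mu1.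
have [|la' [w' E' F']] := IH _ _ wV'; first exact: leq_trans lt_e _.
exists la'; split => // j; rewrite E'.
under eq_bigr do rewrite mulrDl -mulrA.
rewrite big_split /= -mulr_sumr -[RHS]addr0; congr (_ + _).
rewrite (big_setID (fractional V la)) /= (setIidPr _); last first.
  by apply/subsetP => t; rewrite inE => /andP[].
rewrite muE add0r big1 ?mulr0 // => t; rewrite inE => /andP[/mu0 -> _].
by rewrite mul0r.
Qed.

Variables (I : finType) (v : T -> I -> R) (D : R).
Hypotheses (D_ge0 : 0 <= D) (vD : forall t i, `|v t i| <= D).

(* The invariant of Grinberg and Sevastyanov: it bounds the sum over [V] by
   [#|I| * D], and it survives the removal of a suitable element of [V]. *)
Definition balanced (V : {set T}) : Prop :=
  (#|V| <= #|I|)%N \/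
  exists la, [/\ weights V la, forall i, \sum_(t in V) la t * v t i = 0 &
    \sum_(t in V) la t = #|V|%:R - #|I|%:R].

(** Subtracting the vanishing weighted sum leaves the coefficients [1 - la t], which are nonnegative
    with total [#|I|]. *)
Lemma balanced_bound (V : {set T}) i :
  balanced V -> `|\sum_(t in V) v t i| <= #|I|%:R * D.
Proof.
case=> [leVI | [la [wV laE la1]]].
  apply: le_trans (ler_norm_sum _ _ _) _.
  apply: (@le_trans _ _ (\sum_(t in V) D)); first exact: ler_sum.
  by rewrite sumr_const -[D *+ _]mulr_natl ler_wpM2r ?ler_nat.
have -> : \sum_(t in V) v t i = \sum_(t in V) (1 - la t) * v t i.
  under [RHS]eq_bigr do rewrite mulrBl mul1r.
  by rewrite sumrB laE subr0.
apply: le_trans (ler_norm_sum _ _ _) _.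
have -> : #|I|%:R = \sum_(t in V) (1 - la t).
  by rewrite sumrB la1 sumr_const; lra.
rewrite mulr_suml; apply: ler_sum => t Vt; have /andP[l0 l1] := wV _ Vt.
by rewrite normrM ger0_norm ?subr_ge0 // ler_wpM2l ?subr_ge0.
Qed.

Lemma balanced_setT : (forall i, \sum_t v t i = 0) -> balanced [set: T].
Proof.
move=> v0; case: (leqP #|[set: T]| #|I|) => [|ltIT]; first by left.
have T_gt0 : 0 < #|[set: T]|%:R :> R by rewrite ltr0n; apply: leq_trans ltIT.
right; exists (fun=> 1 - #|I|%:R / #|[set: T]|%:R); split.
- move=> t _; rewrite lerBlDl lerDr subr_ge0 ler_pdivrMr // mul1r ler_nat.
  by rewrite (ltnW ltIT) divr_ge0 ?ler0n.
- move=> i; rewrite -mulr_sumr (eq_bigl xpredT) ?v0 ?mulr0 // => t.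
  by rewrite inE.
- by rewrite sumr_const -[LHS]mulr_natl mulrBr mulr1 mulrCA divff ?mulr1 ?gt_eqF.
Qed.

(** Scale the weights so that their total drops by one, then pass to a basic solution; some weight
    must vanish there, and its vector can be removed. *)
Lemma balanced_remove (V : {set T}) :
  balanced V -> (0 < #|V|)%N -> exists2 t, t \in V & balanced (V :\ t).
Proof.
move=> balV /card_gt0P [t0 Vt0].
have cardD t : t \in V -> #|V| = #|V :\ t|.+1 by move=> Vt; rewrite (cardsD1 t) Vt.
have [leVI|ltIV] := leqP #|V| #|I|.
  by exists t0 => //; left; move: leVI; rewrite (cardD _ Vt0) => /ltnW.
case: balV => [|[la [wV laE la1]]]; first by rewrite leqNgt ltIV.
have d_ge1 : 1 <= #|V|%:R - #|I|%:R :> R.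
  by rewrite lerBrDl natr1 ler_nat.
pose c : R := (#|V|%:R - #|I|%:R - 1) / (#|V|%:R - #|I|%:R).
have c01 : 0 <= c <= 1.
  have d_gt0 := lt_le_trans ltr01 d_ge1.
  rewrite /c ler_pdivrMr // mul1r gerBl ler01 andbT divr_ge0 ?(ltW d_gt0) //.
  by rewrite subr_ge0.
have wV' : weights V (fun t => c * la t).
  move=> t /wV /andP[l0 l1]; case/andP: c01 => c0 c1.
  by rewrite mulr_ge0 //= mulr_ile1.
(* The extra coordinate [None] preserves the total weight, at the price of one more fractional
   weight. *)
pose u t (j : option I) := if j is Some i then v t i else 1.
have [la' [w' E' F']] := basic_solution u wV'.
have laE' i : \sum_(t in V) la' t * v t i = 0.
  rewrite (E' (Some i)) /=; under eq_bigr do rewrite -mulrA.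
  by rewrite -mulr_sumr laE mulr0.
have la1' : \sum_(t in V) la' t = #|V|%:R - #|I|%:R - 1.
  have := E' None; rewrite /= -!mulr_suml !mulr1 => ->.
  by rewrite -mulr_sumr la1 divfK // gt_eqF // (lt_le_trans ltr01).
have [/exists_inP[t Vt /eqP lat0]|/exists_inPn la_neq0] :=
    boolP [exists t in V, la' t == 0].
  exists t => //; right; exists la'; split.
  - by move=> t'; rewrite !inE => /andP[_]; apply: w'.
  - by move=> i; have := laE' i; rewrite (big_setD1 t) //= lat0 mul0r add0r.
  - move: la1'; rewrite (big_setD1 t) //= lat0 add0r => ->.
    by rewrite [in LHS](cardD _ Vt) -natr1; ring.
(* If no weight vanishes, the non-fractional ones equal 1. There are at least [#|V| - #|I| - 1] of
   them, which is already the whole total, so nothing is left for the positive fractional weights;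
   without fractional weights the total would be [#|V|]. *)
exfalso.
have la_gt0 t : t \in V -> 0 < la' t.
  by move=> Vt; rewrite lt_def la_neq0 //=; case/andP: (w' _ Vt).
pose F := fractional V la'.
have sFV : F \subset V by apply/subsetP => t; rewrite inE => /andP[].
have sumV : \sum_(t in V) la' t = \sum_(t in F) la' t + #|V :\: F|%:R.
  rewrite (big_setID F) /= (setIidPr sFV); congr (_ + _).
  rewrite -sumr_const; apply: eq_bigr => t; rewrite !inE => /andP[nF Vt].
  have /andP[_ l1] := w' _ Vt; move: nF; rewrite Vt la_gt0 //= -leNgt => l1'.
  by apply/le_anti; rewrite l1.
have cardV : #|V|%:R = #|F|%:R + #|V :\: F|%:R :> R.
  by rewrite -natrD -(cardsID F V) (setIidPr sFV).
have leF : #|F|%:R <= #|I|%:R + 1 :> R by rewrite natr1 ler_nat -card_option.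
have [F0|[t Ft]] := set_0Vmem F.
  have : 0 <= #|I|%:R :> R by exact: ler0n.
  by move: sumV cardV; rewrite F0 big_set0 cards0 mulr0n la1'; lra.
have : 0 < \sum_(t in F) la' t.
  rewrite (big_setD1 t) //= ltr_pwDl ?la_gt0 ?(subsetP sFV) //.
  apply: sumr_ge0 => t'; rewrite inE => /andP[_ /(subsetP sFV) /la_gt0].
  exact: ltW.
by move: sumV; rewrite la1'; lra.
Qed.

(** Elements are listed in order of removal, so each suffix is the set remaining at some stage and
    is balanced. *)
Lemma balanced_ordering (V : {set T}) : balanced V ->
  exists s : seq T, [/\ uniq s, s =i V &
    forall k i, `|\sum_(t <- drop k s) v t i| <= #|I|%:R * D].
Proof.
move cV : #|V| => n; elim: n V cV => [|n IH] V cV balV.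
  exists [::]; split=> // [t|k i].
    by move/eqP: cV; rewrite cards_eq0 => /eqP ->; rewrite inE.
  by rewrite big_nil normr0 mulr_ge0 ?ler0n.
have [|t Vt bal'] := balanced_remove balV; first by rewrite cV.
have [|s [us sV sB]] := IH (V :\ t) _ bal'.
  by move: cV; rewrite (cardsD1 t) Vt => -[].
have uts : uniq (t :: s) by rewrite /= us sV !inE eqxx.
have tsV : t :: s =i V.
  by move=> t'; rewrite inE sV !inE; case: eqP => // ->; rewrite Vt.
exists (t :: s); split=> // -[|k] i; last exact: sB.
rewrite drop0 big_uniq //= (eq_bigl (mem V)) ?balanced_bound //.
Qed.

Lemma steinitz : (forall i, \sum_t v t i = 0) ->
  exists s : seq T, [/\ uniq s, forall t, t \in s &
    forall k i, `|\sum_(t <- drop k s) v t i| <= #|I|%:R * D].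
Proof.
case/balanced_setT/balanced_ordering => s [us sT sB].
by exists s; split=> // t; rewrite sT inE.
Qed.

End Steinitz.

(** * Pigeonhole on the partial sums of integer vectors *)

Section ZeroSumSubfamily.
Local Open Scope ring_scope.
Variables (T I : finType) (w : T -> I -> int) (D : nat).

Lemma zero_sum_proper_subfamily :
    (forall t i, `|w t i| <= D%:Z) -> (forall i, \sum_t w t i = 0) ->
    ((2 * (#|I| * D)).+1 ^ #|I| < #|T|)%N ->
  exists S : {set T}, [/\ S != set0, S != [set: T] &
    forall i, \sum_(t in S) w t i = 0].
Proof.
move=> wD w0 ltT.
have [||| s [us sT sB]] := @steinitz rat T I (fun t i => (w t i)%:~R) D%:R.
- exact: ler0n.
- by move=> t i; rewrite -intr_norm -[D%:R]/(D%:Z%:~R) ler_int.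
- by move=> i; rewrite -rmorph_sum w0.
have ss : size s = #|T|.
  by rewrite -(card_uniqP us); apply: eq_card => t; rewrite sT.
pose M := (#|I| * D)%N.
have {}sB k i : `|\sum_(t <- drop k s) w t i| <= M%:Z.
  rewrite -(ler_int rat) intr_norm rmorph_sum /=; apply: le_trans (sB k i) _.
  by rewrite -natrM.
(* The shift by [M] puts every coordinate between 0 and [2 * M], where neither the absolute value
   nor [inord] loses information. *)
pose code (k : 'I_#|T|) : {ffun I -> 'I_(2 * M).+1} :=
  [ffun i => inord `|(\sum_(t <- drop k s) w t i + M%:Z)%R|%N].
have /injectivePn [j1 [k1 neq1 E1]] : ~~ injectiveb code.
  apply/negP => /injectiveP /leq_card; rewrite card_ffun !card_ord leqNgt.
  by rewrite ltT.
wlog lt_jk : j1 k1 neq1 E1 / (j1 < k1)%N.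
  move=> th; case: (ltngtP j1 k1) => [||/val_inj/eqP]; [exact: th| |].
    by apply: th => //; rewrite eq_sym.
  by rewrite (negbTE neq1).
have {}E1 i : \sum_(t <- drop j1 s) w t i = \sum_(t <- drop k1 s) w t i.
  move/ffunP/(_ i): E1; rewrite !ffunE => /(congr1 val) /=.
  have := sB j1 i; have := sB k1 i.
  by rewrite /= => b1 b2; rewrite !inordK; lia.
(* The suffix at [k1] is thus non-empty, so the zero-sum block [r] before it is not the whole
   family. *)
have lt_k : (k1 < size s)%N by rewrite ss ltn_ord.
pose r := take (k1 - j1) (drop j1 s).
have splits : drop j1 s = r ++ drop k1 s.
  by rewrite -[LHS](cat_take_drop (k1 - j1)) drop_drop subnK ?(ltnW lt_jk).
have ur : uniq (r ++ drop k1 s) by rewrite -splits drop_uniq.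
have sr : size r = (k1 - j1)%N.
  by rewrite size_takel // size_drop leq_sub2r // ltnW.
exists [set t in r]; split.
- case: r sr {ur splits} => [/esym/eqP|t r _].
    by rewrite subn_eq0 leqNgt lt_jk.
  by apply/set0Pn; exists t; rewrite !inE eqxx.
- case E : (drop k1 s) ur (size_drop k1 s) => [|t q] ur szq.
    by move: lt_k; rewrite -subn_gt0 -szq.
  apply/negP => /eqP /setP /(_ t); rewrite !inE => tr.
  by move: ur; rewrite cat_uniq /= tr andbF.
move=> i; have := E1 i; rewrite splits big_cat /= => /eqP.
rewrite -subr_eq0 addrK => /eqP r0; rewrite -[RHS]r0.
rewrite [RHS]big_uniq /=; last by move: ur; rewrite cat_uniq => /andP[].
by apply: eq_bigl => t; rewrite inE.
Qed.

End ZeroSumSubfamily.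

(** * Sublists given by sets of positions *)

Section SubSequence.
Variable (A : eqType) (s : seq A).

(** Positions rather than values are selected, so that repeated entries stay distinct. *)
Definition subseq_of (P : {set 'I_(size s)}) : seq A :=
  [seq tnth (in_tuple s) i | i <- enum P].

Lemma size_subseq_of P : size (subseq_of P) = #|P|.
Proof. by rewrite size_map -cardE. Qed.

Lemma perm_subseq_of P : perm_eq s (subseq_of P ++ subseq_of (~: P)).
Proof.
rewrite -map_cat.
suff : perm_eq (enum 'I_(size s)) (enum P ++ enum (~: P)).
  by move/(perm_map (tnth (in_tuple s))); rewrite map_tnth_enum.
rewrite perm_sym.
have -> : enum (~: P) = filter (predC (mem P)) (enum 'I_(size s)).
  by rewrite enumT; apply: eq_filter => i; rewrite !inE.
have -> : enum P = filter (mem P) (enum 'I_(size s)) by rewrite enumT.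
by rewrite perm_filterC.
Qed.

Lemma sum_subseq_of (V : nmodType) P (f : A -> V) :
  (\sum_(a <- subseq_of P) f a = \sum_(i in P) f (tnth (in_tuple s) i))%R.
Proof. by rewrite big_map big_enum. Qed.

Lemma subseq_ofT : subseq_of [set: 'I_(size s)] = s.
Proof. by rewrite /subseq_of enum_setT -enumT map_tnth_enum. Qed.

End SubSequence.

(** * Exchanging parts of factorizations *)

Section Factorizations.
Variable G : finZmodType.
Implicit Types (x z c : seq (gseq G)) (B : gseq G).

Lemma pi_cat x z g : pi (x ++ z) g = pi x g + pi z g.
Proof. by rewrite !ffunE big_cat. Qed.

Lemma perm_pi x z : perm_eq x z -> pi x = pi z.
Proof. by move=> xz; apply/ffunP => g; rewrite !ffunE (perm_big z). Qed.

Lemma mulrn_card (g : G) : (g *+ #|G| = 0)%R.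
Proof.
by have := @expg_cardG G [set: G]%G g (in_setT g); rewrite cardsT.
Qed.

(** Since [#|G|] copies of [g] have sum zero, a larger multiplicity would contradict minimality. *)
Lemma atom_le_card (A : gseq G) g : atom A -> A g <= #|G|.
Proof.
case=> _ [_ minA]; rewrite leqNgt; apply/negP => ltA.
pose S : gseq G := [ffun h => if h == g then #|G| else 0].
have n_gt0 : 0 < #|G| by apply/card_gt0P; exists g.
have SA : S = A.
  apply: minA.
  - by move=> h; rewrite ffunE; case: eqP => // ->; exact: ltnW.
  - by rewrite /slen (bigD1 g) //= ffunE eqxx ltn_addr.
  - rewrite /zero_sum /ssum (bigD1 g) //= ffunE eqxx mulrn_card add0r.
    by rewrite big1 // => h /negbTE hg; rewrite ffunE hg.
by move: ltA; rewrite -SA ffunE eqxx ltnn.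
Qed.

Lemma sum_count_mem (A : eqType) (r c : seq A) :
  uniq r -> {subset c <= r} -> \sum_(a <- r) count_mem a c = size c.
Proof.
move=> ur cr; rewrite -sum1_size.
under eq_bigr do rewrite -sum1_count big_mkcond.
rewrite exchange_big /= big_seq [RHS]big_seq; apply: eq_bigr => b /cr br.
rewrite -big_mkcond sum1_count -[RHS]/(true : nat) -br -(count_uniq_mem b ur).
by apply: eq_count => a /=; rewrite eq_sym.
Qed.

Lemma fdist_le c x z z' :
  perm_eq z (c ++ z') -> fdist (c ++ x) z <= maxn (size x) (size z').
Proof.
move=> zE; suff cg : size c <= gcd_len (c ++ x) z.
  have sz : size z = size c + size z' by rewrite (perm_size zE) size_cat.
  by rewrite /fdist size_cat sz; lia.
rewrite -(@sum_count_mem _ (undup (c ++ x)) c) ?undup_uniq //; last first.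
  by move=> A cA; rewrite mem_undup mem_cat cA.
apply: leq_sum => A _; rewrite (permP zE) !count_cat.
by rewrite leq_min !leq_addr.
Qed.

(** The number of lattice points of the Steinitz box in dimension [#|G| + 1] (the group elements and
    the length) for entries of size at most [#|G|]. *)
Definition distance_bound : nat := (2 * (#|G|.+1 * #|G|)).+1 ^ #|G|.+1.

Lemma split_longer x z :
    factorization x -> factorization z -> pi x = pi z -> size z <= size x ->
    distance_bound < 2 * size x ->
  exists x1 x2 z1 z2,
    [/\ perm_eq x (x1 ++ x2) /\ perm_eq z (z1 ++ z2),
        pi x1 = pi z1 /\ pi x2 = pi z2,
        size z1 <= size x1 /\ size z2 <= size x2 &
        0 < size x1 /\ 0 < size x2].
Proof.
move=> Fx Fz pixz lezx ltK; pose d := size x - size z.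
(* With the [d] padding vectors the family has exactly [2 * size x] members. *)
pose T := ('I_(size x) + 'I_(size z) + 'I_d)%type.
pose w (t : T) (i : option G) : int :=
  match t, i with
  | inl (inl j), Some g => tnth (in_tuple x) j g
  | inl (inl j), None => 1
  | inl (inr j), Some g => - (tnth (in_tuple z) j g)%:Z
  | inl (inr j), None => -1
  | inr _, Some g => 0
  | inr _, None => -1
  end%R.
pose S1 (S : {set T}) := [set j | inl (inl j) \in S].
pose S2 (S : {set T}) := [set j | inl (inr j) \in S].
pose S3 (S : {set T}) := [set j | inr j \in S].
have sumS (f : T -> int) (S : {set T}) :
    (\sum_(t in S) f t = \sum_(j in S1 S) f (inl (inl j))
    + \sum_(j in S2 S) f (inl (inr j)) + \sum_(j in S3 S) f (inr j))%R.
  rewrite big_sumType big_sumType /=.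
  by congr (_ + _ + _)%R; apply: eq_bigl => j; rewrite inE.
have sumg (S : {set T}) g : (\sum_(t in S) w t (Some g))%R =
    ((pi (subseq_of (S1 S)) g)%:Z - (pi (subseq_of (S2 S)) g)%:Z)%R.
  rewrite sumS /= [X in (_ + X)%R]big1 // addr0 !ffunE.
  by rewrite sumrN !(big_morph Posz PoszD (erefl (Posz 0))) !sum_subseq_of.
have sum1 (S : {set T}) : (\sum_(t in S) w t None)%R =
    ((size (subseq_of (S1 S)))%:Z - (size (subseq_of (S2 S)))%:Z - #|S3 S|%:Z)%R.
  rewrite sumS /= !sumr_const !size_subseq_of.
  by rewrite !mulNrn !natz.
have sumT i : (\sum_t w t i = 0)%R.
  rewrite (eq_bigl (mem [set: T])) => [|t]; last by rewrite /= inE.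
  have T1 : S1 [set: T] = setT by apply/setP => j; rewrite !inE.
  have T2 : S2 [set: T] = setT by apply/setP => j; rewrite !inE.
  have T3 : S3 [set: T] = setT by apply/setP => j; rewrite !inE.
  case: i => [g|]; first by rewrite sumg T1 T2 !subseq_ofT pixz subrr.
  by rewrite sum1 T1 T2 T3 !subseq_ofT cardsT card_ord -subzn // subrr.
have [|||S [S_n0 S_nT S0]] := @zero_sum_proper_subfamily T _ w #|G|.
- have n_gt0 : 0 < #|G| by apply/card_gt0P; exists 0%R.
  case=> [[j|j]|j] [g|] //=; rewrite ?normrN ?normr1 ?normr0 ?lez_nat //.
  + exact/atom_le_card/Fx/mem_tnth.
  + exact/atom_le_card/Fz/mem_tnth.
- exact: sumT.
- rewrite card_option !card_sum !card_ord; move: ltK; rewrite /distance_bound /d.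
  by move/leq_trans; apply; lia.
(* The length coordinate shows that [size a] is [size b] plus the number of padding vectors in [P];
   hence an empty [a] would make [P] empty. *)
have key (P : {set T}) : P != set0 -> (forall i, \sum_(t in P) w t i = 0)%R ->
  let a := subseq_of (S1 P) in let b := subseq_of (S2 P) in
  [/\ pi a = pi b, size b <= size a & 0 < size a].
  move=> P_n0 P0 a b.
  have piab : pi a = pi b.
    apply/ffunP => g; have /eqP := P0 (Some g).
    by rewrite sumg subr_eq0 eqz_nat => /eqP.
  have sab : size a = size b + #|S3 P|.
    have /eqP := P0 None.
    by rewrite sum1 subr_eq0 subr_eq -PoszD addnC eqz_nat => /eqP.
  split=> //; first by rewrite sab leq_addr.
  rewrite lt0n; apply: contra P_n0; rewrite sab addn_eq0 => /andP[/eqP b0 /eqP c0].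
  have a0 : size a = 0 by rewrite sab b0 c0.
  move: a0 b0; rewrite !size_subseq_of => /eqP + /eqP; move/eqP: c0.
  rewrite !cards_eq0 => /eqP/setP c0 /eqP/setP a0 /eqP/setP b0.
  apply/eqP/setP => -[[j|j]|j].
  - by have := a0 j; rewrite !inE.
  - by have := b0 j; rewrite !inE.
  - by have := c0 j; rewrite !inE.
have [e1 l1 p1] := key _ S_n0 S0.
have [||e2 l2 p2] := key (~: S).
- by apply: contra S_nT => /eqP SC; rewrite -[S]setCK SC setC0.
- move=> i; have := sumT i; rewrite (bigID (mem S)) /= S0 add0r => E.
  by rewrite -[RHS]E; apply: eq_bigl => t; rewrite inE.
exists (subseq_of (S1 S)), (subseq_of (~: S1 S)).
exists (subseq_of (S2 S)), (subseq_of (~: S2 S)).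
have C1 : ~: S1 S = S1 (~: S) by apply/setP => i; rewrite !inE.
have C2 : ~: S2 S = S2 (~: S) by apply/setP => i; rewrite !inE.
by rewrite {2}C1 {2}C2; split; split; rewrite ?perm_subseq_of ?C1 ?C2.
Qed.

(** The last clause excludes length differences of opposite signs in the two parts, so exchanging
    one part gives a length between the two original ones. *)
Lemma split_pair x z :
    factorization x -> factorization z -> pi x = pi z ->
    distance_bound < maxn (size x) (size z) ->
  exists x1 x2 z1 z2,
    [/\ perm_eq x (x1 ++ x2) /\ perm_eq z (z1 ++ z2),
        pi x1 = pi z1 /\ pi x2 = pi z2,
        0 < size x1 + size z1 /\ 0 < size x2 + size z2 &
        (size z1 <= size x1) && (size z2 <= size x2) ||
        (size x1 <= size z1) && (size x2 <= size z2)].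
Proof.
move=> Fx Fz pixz ltK; have [lezx|/ltnW lexz] := leqP (size z) (size x).
  have [||x1 [x2 [z1 [z2 [[px pz] [e1 e2] [l1 l2] [p1 p2]]]]]] :=
    split_longer Fx Fz pixz => //; first by lia.
  by exists x1, x2, z1, z2; split=> //; rewrite ?l1 ?l2 // !addn_gt0 p1 p2.
have [||z1 [z2 [x1 [x2 [[pz px] [e1 e2] [l1 l2] [p1 p2]]]]]] :=
  split_longer Fz Fx (esym pixz) => //; first by lia.
exists x1, x2, z1, z2; split=> //; rewrite ?l1 ?l2 ?orbT //.
by rewrite !addn_gt0 p1 p2 !orbT.
Qed.

Lemma factorization_cat x z :
  factorization (x ++ z) <-> factorization x /\ factorization z.
Proof.
split=> [F | [Fx Fz] A]; last by rewrite mem_cat => /orP[/Fx|/Fz].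
by split=> A xA; apply: F; rewrite mem_cat xA ?orbT.
Qed.

Lemma perm_factorization x z :
  perm_eq x z -> factorization x -> factorization z.
Proof. by move=> xz Fx A; rewrite -(perm_mem xz) => /Fx. Qed.

(* A splitting of the difference [x' - z'] yields the factorization that
   exchanges only [z1] for [x1]. Its length lies between the two adjacent
   lengths, hence is one of them, and one of the two parts alone already
   realises the length [k]. *)
Lemma close_factorization z k c x z' :
    factorization z -> adjacent_lengths (pi z) k (size z) ->
    perm_eq z (c ++ z') -> factorization x -> pi x = pi z' ->
    size c + size x = k ->
  exists y, [/\ factorization y, pi y = pi z, size y = k &
    fdist y z <= distance_bound].
Proof.
move=> Fz adj; have [n] := ubnP (size x + size z').
elim: n c x z' => // n IH c x z' lt_n zE Fx pixz sk.
have [Fc Fz'] : factorization c /\ factorization z'.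
  by apply/factorization_cat; apply: perm_factorization Fz.
have exchange_pi (c1 y1 z1 : seq (gseq G)) :
    perm_eq z (c1 ++ z1) -> pi y1 = pi z1 -> pi (c1 ++ y1) = pi z.
  by move=> /perm_pi -> E; apply/ffunP => g; rewrite !pi_cat E.
have [leK|] := leqP (maxn (size x) (size z')) distance_bound.
  exists (c ++ x); split.
  - by apply/factorization_cat.
  - exact: exchange_pi pixz.
  - by rewrite size_cat.
  - exact: leq_trans (fdist_le _ zE) leK.
case/(split_pair Fx Fz' pixz) => x1 [x2 [z1 [z2 [[px pz] [e1 e2] [p1 p2] cmp]]]].
have [Fx1 Fx2] : factorization x1 /\ factorization x2.
  by apply/factorization_cat; apply: perm_factorization Fx.
have [Fz1 Fz2] : factorization z1 /\ factorization z2.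
  by apply/factorization_cat; apply: perm_factorization Fz'.
have zE1 : perm_eq z ((c ++ z2) ++ z1).
  by rewrite (perm_trans zE) // -catA perm_cat2l (perm_trans pz) // perm_catC.
have zE2 : perm_eq z ((c ++ z1) ++ z2).
  by rewrite (perm_trans zE) // -catA perm_cat2l.
have sx : size x = size x1 + size x2 by rewrite (perm_size px) size_cat.
have sz' : size z' = size z1 + size z2 by rewrite (perm_size pz) size_cat.
have sz : size z = size c + size z' by rewrite (perm_size zE) size_cat.
(* If the first part carries the whole length difference, [z2] joins the common part. *)
have [eqd|neqd] := eqVneq (size x1 + size z') (size x + size z1).
  by apply: (IH (c ++ z2) x1 z1) => //; rewrite ?size_cat; lia.
have inL : in_L (pi z) (size c + size z2 + size x1).
  exists ((c ++ z2) ++ x1); split; last by rewrite !size_cat (exchange_pi _ _ z1).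
  by do !(apply/factorization_cat; split).
(* The new length is not [k], so by adjacency it is [size z]. Then [x1] and [z1] have equal size,
   and the second part carries the whole difference. *)
have [kl [_ [_ /(_ _ inL)/negP adjL]]] := adj.
by apply: (IH (c ++ z1) x2 z2) => //; rewrite ?size_cat; lia.
Qed.

(** Over the trivial group every atom consists of a single 0. *)
Lemma trivial_group_size z : #|G| = 1 -> factorization z -> size z = pi z 0%R.
Proof.
move=> G1 Fz; rewrite ffunE -sum1_size big_seq [RHS]big_seq.
apply: eq_bigr => A /Fz atA; apply/esym/eqP; rewrite eqn_leq -{1}G1.
rewrite atom_le_card //=; case: atA => + _.
rewrite /slen (bigD1 0%R) //= big1 ?addn0 // => g g0.
have := subset_leq_card (subsetT [set g; 0%R]).
by rewrite cards2 g0 cardsT G1.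
Qed.

(** With [n = #|G|], the base [2 * (n + 1) * n + 1] is at most [(2 * n) ^ 2] once [n] is at least
    2. *)
Lemma distance_bound_le :
  1 < #|G| -> distance_bound <= (2 * #|G|) ^ (3 * #|G| + 1).
Proof.
move=> n_gt1; apply: (@leq_trans ((2 * #|G|) ^ (2 * #|G|.+1))); last first.
  by rewrite leq_pexp2l //; lia.
by rewrite expnM leq_exp2r //; nia.
Qed.

End Factorizations.

(** Excluded middle replaces a decision procedure for [P], which is later [delta_prop z]. *)
Lemma ex_least (P : nat -> Prop) n :
  P n -> exists2 m, P m & m <= n /\ forall m', P m' -> m <= m'.
Proof.
elim/ltn_ind: n => n IH Pn.
have [[m [lt_mn Pm]]|no] := classic (exists m, m < n /\ P m).
  have [m' Pm' [le_m' min']] := IH m lt_mn Pm.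
  by exists m' => //; split=> //; apply: leq_trans le_m' (ltnW lt_mn).
exists n => //; split=> // m Pm; rewrite leqNgt; apply/negP => lt_mn.
by apply: no; exists m.
Qed.

(* delta(G) = sup_z delta(z) <= (2|G|)^(3|G|+1): every factorization z has
   a well-defined delta(z), bounded by the constant. *)
Theorem theorem6p5 (G : finZmodType) :
  forall z : seq (gseq G), factorization z ->
    exists m, is_delta z m /\ m <= (2 * #|G|) ^ (3 * #|G| + 1).
Proof.
move=> z Fz; suff /ex_least [m Pm [lem minm]] :
  delta_prop z ((2 * #|G|) ^ (3 * #|G| + 1)) by exists m; split.
move=> k _ adj; have [kz [[x [Fx [pix sx]]] _]] := adj.
(* For the trivial group [distance_bound] is 25 and exceeds the claimed 16, but there all
   factorizations of a sequence have the same length. *)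
have [n_le1|n_gt1] := leqP #|G| 1.
  have G1 : #|G| = 1.
    by apply/eqP; rewrite eqn_leq n_le1; apply/card_gt0P; exists 0%R.
  by case: kz; rewrite -sx !trivial_group_size // pix.
have [y [Fy piy sy ley]] :=
  @close_factorization G z k [::] x z Fz adj (perm_refl z) Fx pix sx.
exists y; do !split=> //; apply: leq_trans ley _; exact: distance_bound_le.
Qed.
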